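(* Let $q=p^n$ with $p$ prime and $n\ge 1$, and let $m\ge 2$ be an integer. For $d\ge 1$ let $N_m(d)$ be the number of normalized polynomials of degree exactly $d$ in $\mathbb{F}_q[x_1,\ldots,x_m]$ and let $I_m(d)$ be the number of normalized irreducible polynomials of degree exactly $d$ in $\mathbb{F}_q[x_1,\ldots,x_m]$. Then, as $d\to+\infty$ (with $q$ and $m$ fixed), $$1-\frac{I_m(d)}{N_m(d)} \sim N_m(1)\cdot\frac{N_m(d-1)}{N_m(d)} \sim \frac{q^{m+1}-q}{q-1}\cdot\frac{1}{q^{\binom{m+d-1}{m-1}}}.$$
   Context: $\mathbb{F}_q$ is the finite field with $q$ elements; degree means total degree; $u(d)\sim v(d)$ means $u(d)/v(d)\to 1$ as $d\to+\infty$. A polynomial of degree exactly $d$ is called normalized if, for a fixed ordering of the monomials of degree $d$ in $x_1,\ldots,x_m$, the first non-zero coefficient among its degree-$d$ coefficients is equal to $1$. Thus each nonzero polynomial is uniquely $c\cdot f$ with $c\in\mathbb{F}_q^*$ and $f$ normalized, and the number of normalized polynomials (respectively normalized irreducible polynomials) of degree $d$ is the number of all polynomials (respectively all irreducible polynomials) of degree $d$ divided by $q-1$. *)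

(* Defs.v *)
(* mpoly has to be loaded before the analysis files (notation levels). *)
From mathcomp Require Export all_boot all_order all_algebra.
From mathcomp Require Export finmap mpoly.
From mathcomp Require Export all_classical reals topology normedtype sequences.
Export numFieldNormedType.Exports.
Import GRing.Theory.

Set Implicit Arguments.
Unset Strict Implicit.
Unset Printing Implicit Defensive.

Local Open Scope classical_set_scope.
Local Open Scope ring_scope.

(* A choice, for every degree d, of an ordering of the monomials of degree d
   in m variables: [s d] lists them, each exactly once, in that order. *)
Definition monomial_ordering (m : nat) (s : nat -> seq 'X_{1..m}) : Prop :=
  forall d : nat, uniq (s d) /\ (forall k, (k \in s d) = (mdeg k == d)).

(* [msize f] is one plus the total degree of f, and 0 for f = 0. *)
Definition normalized (F : finFieldType) (m : nat) (s : nat -> seq 'X_{1..m})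
    (d : nat) (f : {mpoly F[m]}) : Prop :=
  msize f = d.+1 /\
  ohead [seq c <- [seq f@_k | k <- s d] | c != 0] = Some 1.

Definition irreducible (A : idomainType) (x : A) : Prop :=
  [/\ x != 0, x \isn't a GRing.unit
    & forall a b : A, x = a * b -> a \is a GRing.unit \/ b \is a GRing.unit].

Definition num_normalized (F : finFieldType) (m : nat)
    (s : nat -> seq 'X_{1..m}) (d : nat) : nat :=
  #|` fset_set [set f : {mpoly F[m]} | normalized s d f]|.

Definition num_normalized_irreducible (F : finFieldType) (m : nat)
    (s : nat -> seq 'X_{1..m}) (d : nat) : nat :=
  #|` fset_set [set f : {mpoly F[m]} | normalized s d f /\ irreducible f]|.

(* [fset_set] is empty on infinite sets; the sets counted above are finite. *)
Lemma finite_normalized (F : finFieldType) (m : nat)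
    (s : nat -> seq 'X_{1..m}) (d : nat) :
  finite_set [set f : {mpoly F[m]} | normalized s d f].
Proof.
pose g (c : {ffun 'X_{1..m < d.+1} -> F}) : {mpoly F[m]} :=
  \sum_(k : 'X_{1..m < d.+1}) c k *: 'X_[k].
apply: (@sub_finite_set _ _ (g @` setT)); last exact/finite_image/finite_finset.
move=> f [fd _]; exists [ffun k : 'X_{1..m < d.+1} => f@_k] => //.
rewrite [RHS](@mpolywE _ _ d.+1) ?fd //.
by apply: eq_bigr => k _; rewrite ffunE.
Qed.

(* With the convention x / 0 = 0, this forces v to be eventually nonzero. *)
Definition asymp_equiv (R : realType) (u v : nat -> R) : Prop :=
  (fun d => u d / v d) @ \oo --> (1 : R).

(* Main.v *)
(* Write a_d = 'C(m + d, m), so that (q - 1) N(d) = q ^ a_d - q ^ a_(d-1) and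
   N(d) is q ^ a_d up to a factor q.  A reducible polynomial of degree d is, up
   to a scalar, a product g * h of normalized polynomials with
   1 <= deg g <= deg h, so at most N(1) N(d-1) + \sum_(2 <= k <= d-2) N(k) N(d-k)
   of them are normalized.  As a is convex, each term of the last sum is at most
   q ^ (a_2 + a_(d-2)), which is exponentially small with respect to N(d-1).
   In particular almost all polynomials are irreducible.  Conversely,
   (l, g) |-> l * g is injective up to scalars on pairs made of a normalized
   linear l and a normalized irreducible g of degree d-1 > 1, because linear
   polynomials are prime; this gives N(1) I(d-1) reducible polynomials, which
   is asymptotically N(1) N(d-1). *)
From mathcomp Require Import zify ring lra.
Require Import Defs.
Import Order.TTheory GRing.Theory Num.Theory.
Local Open Scope classical_set_scope.
Local Open Scope ring_scope.

Set Implicit Arguments.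
Unset Strict Implicit.
Unset Printing Implicit Defensive.

(** * Cardinals of finite sets: images, products and covers *)

Lemma card_fset_set_image (T U : choiceType) (f : T -> U) (A : set T) :
  finite_set A -> {in A &, injective f} ->
  #|` fset_set [set f x | x in A]| = #|` fset_set A|.
Proof.
move=> finA injf; rewrite fset_set_image // card_in_imfset //= => x y.
by rewrite !in_fset_set //; apply: injf.
Qed.

Lemma card_fset_set_sub (T : choiceType) (A B : set T) :
  finite_set B -> A `<=` B -> (#|` fset_set A| <= #|` fset_set B|)%N.
Proof.
move=> finB sAB; apply: fsubset_leq_card.
by rewrite -fset_set_sub //; apply: sub_finite_set finB.
Qed.

Lemma card_fset_set_image_le (T U : choiceType) (f : T -> U) (A : set T) :
  finite_set A -> (#|` fset_set [set f x | x in A]| <= #|` fset_set A|)%N.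
Proof. by move=> finA; rewrite fset_set_image // leq_imfset_card. Qed.

Lemma card_fset_setX (T U : choiceType) (A : set T) (B : set U) :
  finite_set A -> finite_set B ->
  #|` fset_set (A `*` B)| = (#|` fset_set A| * #|` fset_set B|)%N.
Proof.
move=> finA finB; rewrite fset_setX // -(size_allpairs pair).
apply/perm_size/uniq_perm; rewrite ?allpairs_uniq ?fset_uniq //.
  by move=> [x y] [x' y'].
move=> [x y]; rewrite in_fsetM /=; apply/andP/allpairsP => [[xA yB]|].
  by exists (x, y).
by move=> [[u v] /= [uA vB [-> ->]]].
Qed.

Lemma card_fset_setT (T : finType) : #|` fset_set [set: T]| = #|T|.
Proof.
rewrite cardE; apply/perm_size/uniq_perm; rewrite ?fset_uniq ?enum_uniq //.
move=> x; rewrite in_fset_set; last exact: finite_finset.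
by rewrite (mem_enum T) !inE; apply: mem_set.
Qed.

Lemma card_fset_set_cover_le (I T : choiceType) (r : seq I) (A : I -> set T)
    (B : set T) :
  (forall i, finite_set (A i)) -> (forall x, B x -> exists2 i, i \in r & A i x) ->
  (#|` fset_set B| <= \sum_(i <- r) #|` fset_set (A i)|)%N.
Proof.
move=> finA; elim: r B => [|i r IH] B rB.
  have -> : B = set0 by apply/seteqP; split=> x // /rB[].
  by rewrite fset_set0 cardfs0 big_nil.
(* Finiteness has to be drawn from the cover, because [fset_set] sends an infinite set to the empty
   one. *)
have finAB : finite_set (A i `|` B `\` A i).
  rewrite setDE setUIr setUCr setIT.
  apply: (@sub_finite_set _ _ (\bigcup_(j in [set` i :: r]) A j)); last first.
    by apply: bigcup_finite => //; apply: finite_seq.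
  by move=> x [xi|/rB[j]]; [exists i => //=; rewrite inE eqxx|exists j].
have sB : B `<=` A i `|` B `\` A i.
  by move=> x Bx; have [|] := pselect (A i x); [left|right].
rewrite big_cons (leq_trans (card_fset_set_sub finAB sB)) //.
move: finAB; rewrite finite_setU => -[_ finB].
rewrite fset_setU // (leq_trans (leq_card_fsetU _ _)) // leq_add2l.
apply: IH => x [/rB[j]]; rewrite inE => /orP[/eqP->//|jr Aj _].
by exists j.
Qed.

(** * Binomial and exponential inequalities *)

Lemma binD1l m d : (0 < m)%N -> 'C(m + d.+1, m) = ('C(m + d, m) + 'C(m + d, m - 1))%N.
Proof. by case: m => // m _; rewrite addnS binS subn1. Qed.

Lemma ltn_bin_addl M d : (0 < M)%N -> (d < 'C(M + d, M))%N.
Proof.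
case: M => // M _; elim: M => [|M IH]; first by rewrite bin1 add1n.
by rewrite addSn binS (leq_trans IH) // leq_addl.
Qed.

(** By Pascal's rule the increments are ['C(m + x, m - 1)], which grow with [x]; induct on [i]. *)
Lemma leq_bin_convex m x y i : (0 < m)%N -> (x <= y)%N ->
  ('C(m + (x + i), m) + 'C(m + y, m) <= 'C(m + x, m) + 'C(m + (y + i), m))%N.
Proof.
move=> m0 xy; elim: i => [|i IH]; first by rewrite !addn0.
rewrite !(addnS _ i) !binD1l //.
have : ('C(m + (x + i), m - 1) <= 'C(m + (y + i), m - 1))%N.
  by apply: leq_bin2l; lia.
by move: IH; lia.
Qed.

Lemma sqr_le_exp2 d : (d.+1 ^ 2 <= 4 * 2 ^ d)%N.
Proof.
(* Doubling beats the growth of the square only from 2 on, so 0 and 1 are checked apart. *)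
case: d => [//|[//|d]]; elim: d => [//|d IH].
by rewrite (expnS 2 d.+2); move: IH; rewrite -!mulnn; nia.
Qed.

(** Trades an exponential gain for a linear one, which suffices for the limits:
    [d.+1 ^ 2 <= 4 * q ^ d.+2] and [a + d * b <= d.+1 * (a + b)], and one factor [d.+1] cancels. *)
Lemma leq_exp_linear q d a b x y : (1 < q)%N ->
  (q ^ d.+2 * x <= (a + d * b) * y)%N -> (d.+1 * x <= 4 * (a + b) * y)%N.
Proof.
move=> q1 xy; rewrite -(leq_pmul2l (ltn0Sn d)).
have q2 : (2 ^ d <= q ^ d.+2)%N.
  by apply: (@leq_trans (2 ^ d.+2)); rewrite ?leq_exp2l ?leq_exp2r //; lia.
apply: leq_trans (_ : 4 * (q ^ d.+2 * x) <= _)%N.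
  rewrite [leqLHS]mulnA [leqRHS]mulnA leq_mul2r; apply/orP; right.
  by rewrite mulnn (leq_trans (sqr_le_exp2 d)) // leq_mul2l q2.
have : (4 * ((a + d * b) * y) <= d.+1 * (4 * (a + b) * y))%N; last by lia.
rewrite !mulnA leq_mul2r; apply/orP; right; nia.
Qed.

(** * Normalization of polynomials *)

Section Polynomials.
Variables (m : nat) (F : finFieldType) (s : nat -> seq 'X_{1..m}).
Hypothesis hs : monomial_ordering s.
Implicit Types f g : {mpoly F[m]}.

(** The default 0 cannot be mistaken for a first coefficient, as zeros are filtered out. *)
Definition first_coef d f : F :=
  head 0 [seq c <- [seq f@_k | k <- s d] | c != 0].

Lemma first_coefZ c d f : c != 0 -> first_coef d (c *: f) = c * first_coef d f.
Proof.
move=> c0; rewrite /first_coef; elim: (s d) => [|k t IH] /=; first by rewrite mulr0.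
by rewrite mcoeffZ mulf_eq0 (negPf c0) /=; case: ifP.
Qed.

(** The leading monomial of [f] has degree [d], so it is listed in [s d] and the filtered list is
    not empty. *)
Lemma first_coef_neq0 d f : msize f = d.+1 -> first_coef d f != 0.
Proof.
move=> fd; have f0 : f != 0 by rewrite -msize_poly_eq0 fd.
have [_ /(_ (mlead f))] := hs d.
have -> : mdeg (mlead f) = d by move: (mlead_deg f0); rewrite fd => -[].
rewrite eqxx => fs; rewrite /first_coef.
set t := [seq c <- _ | _].
have: mleadc f \in t.
  by rewrite mem_filter mleadc_eq0 f0 (map_f (fun k => f@_k)) ?fs.
have: all (fun c => c != 0) t by apply: filter_all.
by case: t => //= a l /andP[].
Qed.

Lemma normalizedE d f : normalized s d f <-> msize f = d.+1 /\ first_coef d f = 1.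
Proof.
rewrite /normalized /first_coef; split=> -[-> H]; split=> //; move: H;
  case: [seq c <- _ | _] => //=.
- by move=> a l [].
- by move/eqP; rewrite eq_sym oner_eq0.
- by move=> a l ->.
Qed.

Lemma mpoly_unitE f : (f \is a GRing.unit) = (msize f == 1%N).
Proof.
apply/idP/eqP => [/andP[/eqP fE fu]|/eqP/msize_poly1P[c c0 ->]].
  by rewrite fE msizeC; move: fu; rewrite unitfE => ->.
by apply/andP; rewrite mcoeffC eqxx mulr1 unitfE.
Qed.

Definition normalize d f := (first_coef d f)^-1 *: f.

Lemma normalize_normalized d f : msize f = d.+1 -> normalized s d (normalize d f).
Proof.
move=> fd; have c0 := first_coef_neq0 fd; apply/normalizedE.
by rewrite msizeZ ?first_coefZ ?invr_eq0 // mulVf.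
Qed.

Lemma normalizeZ c d f : c != 0 -> normalize d (c *: f) = normalize d f.
Proof.
move=> c0; rewrite /normalize first_coefZ // invfM scalerA.
by rewrite mulrAC mulVf // mul1r.
Qed.

Lemma normalized_msize d f : normalized s d f -> msize f = d.+1.
Proof. by case. Qed.

Lemma normalized_neq0 d f : normalized s d f -> f != 0.
Proof. by move/normalized_msize=> fd; rewrite -msize_poly_eq0 fd. Qed.

Lemma normalized_first_coef d f : normalized s d f -> first_coef d f = 1.
Proof. by case/normalizedE. Qed.

Lemma normalized_inj c d f g : c != 0 -> normalized s d f -> normalized s d g ->
  f = c *: g -> f = g.
Proof.
move=> c0 /normalized_first_coef f1 /normalized_first_coef g1 fg.
by move: f1; rewrite {1}fg first_coefZ // g1 mulr1 => c1; rewrite fg c1 scale1r.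
Qed.

(** * Counting polynomials of given degree *)

Definition mpoly_of_coefs D (c : {ffun 'X_{1..m < D} -> F}) : {mpoly F[m]} :=
  \sum_(k : 'X_{1..m < D}) c k *: 'X_[k].

Lemma mcoeff_mpoly_of_coefs D c (k : 'X_{1..m < D}) : (mpoly_of_coefs c)@_k = c k.
Proof.
rewrite /mpoly_of_coefs raddf_sum /= (bigD1 k) //= mcoeffZ mcoeffX eqxx mulr1.
rewrite big1 ?addr0 // => l /negPf lk; rewrite mcoeffZ mcoeffX.
by rewrite -bmeqP lk mulr0.
Qed.

Lemma mpoly_of_coefs_image D :
  [set mpoly_of_coefs c | c in [set: {ffun 'X_{1..m < D} -> F}]] =
  [set f : {mpoly F[m]} | (msize f <= D)%N].
Proof.
apply/seteqP; split=> f /=.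
  move=> [c _ <-]; apply: (leq_trans (msize_sum _ _ _)).
  by apply/bigmax_leqP=> k _; rewrite (leq_trans (msizeZ_le _ _)) // msizeX bmdeg.
move=> fD; exists [ffun k : 'X_{1..m < D} => f@_k] => //.
by rewrite [RHS](mpolywE fD); apply: eq_bigr => k _; rewrite ffunE.
Qed.

Lemma card_msize_le D :
  #|` fset_set [set f : {mpoly F[m]} | (msize f <= D)%N]| = (#|F| ^ #|{: 'X_{1..m < D}}|)%N.
Proof.
rewrite -mpoly_of_coefs_image card_fset_set_image; first last.
- by move=> c c' _ _ cc'; apply/ffunP=> k; rewrite -!mcoeff_mpoly_of_coefs cc'.
- exact: finite_finset.
- by rewrite card_fset_setT card_ffun.
Qed.

Lemma finite_msize_le D : finite_set [set f : {mpoly F[m]} | (msize f <= D)%N].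
Proof. by rewrite -mpoly_of_coefs_image; apply: finite_image. Qed.

Lemma card_msize_eq D :
  (#|` fset_set [set f : {mpoly F[m]} | msize f = D.+1]| +
   #|F| ^ #|{: 'X_{1..m < D}}| = #|F| ^ #|{: 'X_{1..m < D.+1}}|)%N.
Proof.
rewrite -!card_msize_le.
have -> : [set f : {mpoly F[m]} | msize f = D.+1] =
  [set f : {mpoly F[m]} | (msize f <= D.+1)%N] `\` [set f : {mpoly F[m]} | (msize f <= D)%N].
  apply/seteqP; split=> f /=; first by move=> ->; split=> //; rewrite ltnn.
  by move=> [fD /negP]; rewrite -ltnNge => Df; apply/eqP; rewrite eqn_leq fD Df.
rewrite fset_setD ?cardfsDS -?fset_set_sub; try exact: finite_msize_le.
- by rewrite subnK // card_fset_set_sub; [|exact: finite_msize_le|move=> f /= /leqW].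
- by move=> f /= /leqW.
Qed.

(** Exponent vectors of degree at most [d] are the [m]-tuples over ['I_d.+1] of sum at most [d],
    whose number is known. *)
Lemma card_monomials d : #|{: 'X_{1..m < d.+1}}| = 'C(m + d, m).
Proof.
rewrite -card_partial_ord_partitions.
pose t (k : 'X_{1..m < d.+1}) : m.-tuple 'I_d.+1 := [tuple inord (bmnm k i) | i < m].
have kd (l : 'X_{1..m < d.+1}) i : (bmnm l i < d.+1)%N.
  by rewrite (leq_ltn_trans _ (bmdeg l)) // mdegE (bigD1 i) //= leq_addr.
have tE l i : tnth (t l) i = bmnm l i :> nat by rewrite tnth_mktuple inordK.
rewrite -(@card_codom _ _ t); last first.
  by move=> k l kl; apply/val_inj/mnmP=> i; rewrite -!tE kl.
apply: eq_card => u; rewrite [RHS]inE; apply/codomP/idP => [[k ->]|ud].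
  rewrite big_tuple (eq_bigr (fun i => bmnm k i)) => [|i _]; last by rewrite tE.
  by rewrite -mdegE -ltnS bmdeg.
have uP : (mdeg [multinom (tnth u i : nat) | i < m] < d.+1)%N.
  rewrite mdegE ltnS (leq_trans _ ud) // big_tuple; apply: eq_leq.
  by apply: eq_bigr => i _; rewrite mnmE.
exists (BMultinom uP); apply: eq_from_tnth => i; apply: val_inj.
by rewrite /= tE /= mnmE.
Qed.

Local Notation N d := (num_normalized F s d).

Lemma card_normalized_scale d :
  #|` fset_set [set f : {mpoly F[m]} | msize f = d.+1]| = (#|F|.-1 * N d)%N.
Proof.
have -> : [set f : {mpoly F[m]} | msize f = d.+1] =
  [set x.1 *: x.2 | x in [set c : F | c != 0] `*` [set f | normalized s d f]].
  apply/seteqP; split=> f /= => [fd|[[c g] /= [c0 [gd _]] <-]].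
    exists (first_coef d f, normalize d f) => /=.
      by split; [apply: first_coef_neq0|apply: normalize_normalized].
    by rewrite /normalize scalerA mulfV ?scale1r // first_coef_neq0.
  by rewrite msizeZ.
have finF : finite_set [set c : F | c != 0] by exact: finite_finset.
rewrite card_fset_set_image; first last.
- move=> [c f] [c' f']; rewrite !inE /= => -[c0 fn] [c0' fn'] e.
  (* The scalar is recovered as the first coefficient of the product. *)
  have c_inj (b : F) (g : {mpoly F[m]}) :
      b != 0 -> normalized s d g -> first_coef d (b *: g) = b.
    by move=> b0 /normalized_first_coef g1; rewrite first_coefZ // g1 mulr1.
  have cc' : c = c' by rewrite -(c_inj c f) // e c_inj.
  by move: e; rewrite cc' => /scalerI -> .
- by apply: finite_setX => //; apply: finite_normalized.
rewrite card_fset_setX //; last exact: finite_normalized.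
congr (_ * _)%N; rewrite -(card_fset_setT F).
have -> : [set c : F | c != 0] = [set: F] `\ 0.
  by apply/seteqP; split => c /= => [/eqP|[_ /eqP]].
rewrite fset_setD1; last exact: finite_finset.
rewrite [in RHS](cardfsD1 0) in_fset_set ?mem_setT //; exact: finite_finset.
Qed.

Lemma num_normalizedE d : (#|F|.-1 * N d.+1 + #|F| ^ 'C(m + d, m) = #|F| ^ 'C(m + d.+1, m))%N.
Proof. by rewrite -card_normalized_scale -!card_monomials card_msize_eq. Qed.

(** * Primality of linear polynomials *)

Lemma msizeM_eq k l f g : msize f = k.+1 -> msize g = l.+1 -> msize (f * g) = (k + l).+1.
Proof.
move=> fk gl; rewrite msizeM -?msize_poly_eq0 ?fk ?gl //.
by rewrite addnS addSn.
Qed.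

(* If 'X_i occurs in l with coefficient a, the substitution
   'X_i |-> 'X_i - a^-1 *: l kills l and is the identity modulo l. *)
Lemma linear_prime (l p q r : {mpoly F[m]}) : msize l = 2%N -> l * r = p * q ->
  (exists u, p = l * u) \/ (exists u, q = l * u).
Proof.
move=> l2; have l0 : l != 0 by rewrite -msize_poly_eq0 l2.
have /eqP : mdeg (mlead l) = 1%N by move: (mlead_deg l0); rewrite l2 => -[].
rewrite mdeg_eq1 => /existsP[i /eqP li].
set a := l@_U_(i)%MM; have a0 : a != 0 by rewrite /a -li mleadc_eq0.
pose X j : {mpoly F[m]} := 'X_j - (if j == i then a^-1 *: l else 0).
pose lq := [tuple X j | j < m].
have XE j : 'X_j \mPo lq = X j by rewrite comp_mpolyXU -tnth_nth tnth_mktuple.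
(* The property is stable under sums and products and holds for constants and variables. *)
have phi_mod g : exists u, g \mPo lq = g + l * u.
  pose D g := exists u, g \mPo lq = g + l * u.
  have DD g1 g2 : D g1 -> D g2 -> D (g1 + g2).
    by move=> [u1 e1] [u2 e2]; exists (u1 + u2); rewrite comp_mpolyD e1 e2 mulrDr addrACA.
  have DM g1 g2 : D g1 -> D g2 -> D (g1 * g2).
    move=> [u1 e1] [u2 e2]; exists (g1 * u2 + u1 * g2 + l * u1 * u2).
    by rewrite rmorphM /= e1 e2; ring.
  have DC c : D c%:MP by exists 0; rewrite comp_mpolyC mulr0 addr0.
  rewrite -/(D g) [g]mpolyE; apply: (big_ind D) => [||k _]; first by rewrite -mpolyC0.
    exact: DD.
  rewrite -mul_mpolyC mpolyXE_id; apply: (DM) => //.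
  apply: (big_ind D) => [||j _]; first by rewrite -mpolyC1.
    exact: DM.
  elim: (k j) => [|e IH]; first by rewrite expr0 -mpolyC1.
  rewrite exprS; apply: (DM) => //; rewrite /D XE /X.
  case: eqP => _; last by exists 0; rewrite mulr0 subr0 addr0.
  by exists (- a^-1%:MP); rewrite mulrN mulrC mul_mpolyC.
have phi_l : l \mPo lq = 0.
  suff: l \mPo lq - l = - l by move/(canRL (subrK _)); rewrite addNr.
  rewrite comp_mpolyEX [X in _ - X = _]mpolyE -sumrB (bigD1_seq U_(i)%MM) //=; last first.
    by rewrite mcoeff_msupp.
  rewrite XE /X eqxx scalerBr scalerA mulfV // scale1r [_ - l - _]addrAC subrr add0r.
  rewrite big_seq_cond big1 ?addr0 // => k /andP[kl ki].
  (* The other monomials of [l] are constant or variables other than ['X_i], all fixed by the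
     substitution. *)
  have := msize_mdeg_lt kl; rewrite l2 ltnS leq_eqVlt ltnS leqn0 => /orP[].
    rewrite mdeg_eq1 => /existsP[j /eqP kj]; rewrite kj XE /X.
    case: eqP => [ji|_]; last by rewrite subr0 subrr.
    by rewrite kj ji eqxx in ki.
  by rewrite mdeg_eq0 => /eqP->; rewrite mpolyX0 comp_mpoly1 subrr.
move=> /(congr1 (comp_mpoly lq)); rewrite !rmorphM /= phi_l mul0r => /esym/eqP.
(* One of the images of [p] and [q] vanishes, and each polynomial equals its image modulo [l]. *)
have [u pu] := phi_mod p; have [v qv] := phi_mod q.
rewrite mulf_eq0 => /orP[]/eqP e; [left; exists (- u)|right; exists (- v)].
  by apply/eqP; rewrite mulrN -addr_eq0 -pu e.
by apply/eqP; rewrite mulrN -addr_eq0 -qv e.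
Qed.

(** * Upper and lower bounds for the number of reducible polynomials *)

Definition reducibles d : set {mpoly F[m]} :=
  [set f | normalized s d f /\ ~ irreducible f].

Lemma finite_reducibles d : finite_set (reducibles d).
Proof. by apply: sub_finite_set (finite_normalized F s d) => f []. Qed.

Lemma num_normalized_split d :
  N d = (num_normalized_irreducible F s d + #|` fset_set (reducibles d)|)%N.
Proof.
have finI : finite_set [set f : {mpoly F[m]} | normalized s d f /\ irreducible f].
  by apply: sub_finite_set (finite_normalized F s d) => f [].
rewrite /num_normalized_irreducible -cardfsUI -fset_setU //; last exact: finite_reducibles.
rewrite -fset_setI //; last exact: finite_reducibles.
rewrite (_ : _ `&` _ = set0); last by apply/seteqP; split=> f // [[_ ?] [_]].
rewrite fset_set0 cardfs0 addn0 /num_normalized; congr #|` fset_set _|.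
apply/seteqP; split=> f; last by move=> [] [].
by move=> fd; have [|] := pselect (irreducible f); [left|right].
Qed.

(* The monomial orderings chosen in the various degrees are unrelated, so a
   product of normalized polynomials need not be normalized. *)
Definition norm_mul d (x : {mpoly F[m]} * {mpoly F[m]}) := normalize d (x.1 * x.2).

(** Normalizing the factors changes the product by a scalar only, which the final normalization
    absorbs. *)
Lemma norm_mul_normalize k l f g : msize f = k.+1 -> msize g = l.+1 ->
  normalized s (k + l) (f * g) ->
  norm_mul (k + l) (normalize k f, normalize l g) = f * g.
Proof.
move=> fk gl fg; rewrite /norm_mul /= -scalerAl -scalerAr !normalizeZ.
- by rewrite /normalize (normalized_first_coef fg) invr1 scale1r.
- by rewrite invr_eq0 first_coef_neq0.
- by rewrite invr_eq0 first_coef_neq0.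
Qed.

Lemma reducible_factor d f : reducibles d.+1 f ->
  exists2 k, k \in 1%N :: index_iota 2 d &
    [set norm_mul d.+1 x | x in [set g | normalized s k g] `*`
                                [set h | normalized s (d.+1 - k) h]] f.
Proof.
move=> [fd fI]; have f0 := normalized_neq0 fd; have fsz := normalized_msize fd.
have [[a b] /= fab [a1 [b1 ab]]] : exists2 x : {mpoly F[m]} * {mpoly F[m]},
    f = x.1 * x.2 & (1 < msize x.1)%N /\ (1 < msize x.2)%N /\ (msize x.1 <= msize x.2)%N.
  apply: contrapT => Nab; apply: fI; split=> //; first by rewrite mpoly_unitE fsz.
  move=> a b fab; apply: contrapT => /not_orP[aU bU]; apply: Nab.
  have [a0 b0] : a != 0 /\ b != 0 by move: f0; rewrite fab mulf_eq0 => /norP.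
  have gt1 (c : {mpoly F[m]}) : c != 0 -> ~ c \is a GRing.unit -> (1 < msize c)%N.
    by move=> c0 /negP; rewrite mpoly_unitE; rewrite -msize_poly_eq0 in c0; lia.
  case: (leqP (msize a) (msize b)) => [ab|/ltnW ab].
    by exists (a, b) => //=; split; [|split] => //; apply: gt1.
  by exists (b, a); rewrite /= 1?mulrC //; split; [|split] => //; apply: gt1.
have b0 : b != 0 by rewrite -msize_poly_eq0; lia.
have a0 : a != 0 by rewrite -msize_poly_eq0; lia.
have szab : msize f = (msize a + msize b).-1 by rewrite fab msizeM.
pose k := (msize a).-1; have ak : msize a = k.+1 by rewrite /k; lia.
have bk : msize b = (d.+1 - k).+1 by lia.
(* [k] is the smaller of two degrees of sum [d.+1]: it is 1 or lies in [[2, d)]. *)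
exists k; first by rewrite inE mem_index_iota; lia.
exists (normalize k a, normalize (d.+1 - k) b).
  by split; apply: normalize_normalized.
have dE : d.+1 = (k + (d.+1 - k))%N by lia.
by rewrite {1}dE norm_mul_normalize // -?fab -?dE.
Qed.

Lemma card_reducibles_le d :
  (#|` fset_set (reducibles d.+1)| <=
   N 1 * N d + \sum_(2 <= k < d) N k * N (d.+1 - k))%N.
Proof.
have finA k : finite_set ([set g : {mpoly F[m]} | normalized s k g] `*`
                          [set h : {mpoly F[m]} | normalized s (d.+1 - k) h]).
  by apply: finite_setX; apply: finite_normalized.
have := card_fset_set_cover_le (I := nat) (fun k => finite_image (norm_mul d.+1) (finA k))
  (@reducible_factor d).
move/leq_trans; apply; rewrite big_cons.
apply: leq_add; last apply: leq_sum => k _;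
  (apply: leq_trans (card_fset_set_image_le _ (finA _)) _;
   rewrite card_fset_setX ?subSS ?subn0 //; exact: finite_normalized).
Qed.

(** Up to a scalar [l] divides [l' * g']. If it divides [l'], normalization forces equality; it
    cannot divide [g'], which is irreducible of degree above 1. *)
Lemma norm_mul_linear_inj d l g l' g' : (1 < d)%N ->
  normalized s 1 l -> normalized s d g /\ irreducible g ->
  normalized s 1 l' -> normalized s d g' /\ irreducible g' ->
  norm_mul d.+1 (l, g) = norm_mul d.+1 (l', g') -> (l, g) = (l', g').
Proof.
move=> d1 ln [gn gI] l'n [gn' gI'].
have [l2 l2'] := (normalized_msize ln, normalized_msize l'n).
have [gd gd'] := (normalized_msize gn, normalized_msize gn').
have c0 : (first_coef d.+1 (l * g))^-1 != 0.
  by rewrite invr_eq0 first_coef_neq0 // (msizeM_eq l2 gd).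
have c0' : (first_coef d.+1 (l' * g'))^-1 != 0.
  by rewrite invr_eq0 first_coef_neq0 // (msizeM_eq l2' gd').
rewrite /norm_mul /normalize /=; set c := _^-1; set c' := _^-1.
move/(congr1 (fun f => c^-1 *: f)); rewrite !scalerA mulVf // scale1r.
set e := c^-1 * c'; have e0 : e != 0 := mulf_neq0 (invr_neq0 c0) c0'.
rewrite scalerAr => lg.
case: (linear_prime l2 lg) => -[u lu].
  have u0 : u != 0.
    by apply: contraTneq (normalized_neq0 l'n) => u0; rewrite lu u0 mulr0 eqxx.
  have /msize_poly1P[a a0 ua] : msize u == 1%N.
    by have := msizeM (normalized_neq0 ln) u0; rewrite -lu l2 l2' => -[/esym/eqP].
  have ll' : l' = l.
    by apply: (normalized_inj a0 l'n ln); rewrite lu ua mulrC mul_mpolyC.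
  move: lg; rewrite ll' => /(mulfI (normalized_neq0 ln)) gg'.
  by rewrite (normalized_inj e0 gn gn' gg').
have g'E : g' = l * (e^-1 *: u).
  by rewrite -scalerAr -lu scalerA mulVf // scale1r.
have [_ _ /(_ _ _ g'E)] := gI'; rewrite !mpoly_unitE l2 => -[//|/eqP u1].
by have := msizeM_eq l2 u1; rewrite -g'E gd'; lia.
Qed.

Lemma card_reducibles_ge d : (1 < d)%N ->
  (N 1 * num_normalized_irreducible F s d <= #|` fset_set (reducibles d.+1)|)%N.
Proof.
move=> d1; pose A := [set f : {mpoly F[m]} | normalized s 1 f].
pose B := [set f : {mpoly F[m]} | normalized s d f /\ irreducible f].
have finA : finite_set A by apply: finite_normalized.
have finB : finite_set B by apply: sub_finite_set (finite_normalized F s d) => f [].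
rewrite /num_normalized /num_normalized_irreducible -card_fset_setX //.
rewrite -(card_fset_set_image (f := norm_mul d.+1)); first last.
- move=> [l g] [l' g']; rewrite !inE => -[/= ln gn] [/= ln' gn'].
  exact: norm_mul_linear_inj.
- exact: finite_setX.
apply: card_fset_set_sub; first exact: finite_reducibles.
move=> _ [[l g] /= [ln [gn gI]] <-].
have [l2 gd] := (normalized_msize ln, normalized_msize gn).
have lgd := msizeM_eq l2 gd; split; first exact: normalize_normalized.
move=> [_ _]; rewrite /norm_mul /normalize scalerAl => /(_ _ _ erefl).
rewrite !mpoly_unitE msizeZ ?invr_eq0 ?first_coef_neq0 // l2 gd => -[] //.
by rewrite eqSS => /eqP d0; rewrite d0 in d1.
Qed.

(** * Growth of the counts and error estimates *)

Lemma card_finField_gt1 : (1 < #|F|)%N.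
Proof. by rewrite (cardD1 0) (cardD1 1) !inE oner_eq0. Qed.

Lemma num_normalized_le d : (N d.+1 <= #|F| ^ 'C(m + d.+1, m))%N.
Proof.
rewrite -num_normalizedE; have := card_finField_gt1.
by case: #|F| => [|[|r]] // _; rewrite /= mulSn -addnA leq_addr.
Qed.

Hypothesis hm : (2 <= m)%N.

(** The exponent increases by at least 1 from degree [d] to [d.+1], so subtracting the lower power
    keeps a fraction at least [(q - 1) / q] of the upper one, where [q] is [#|F|]. *)
Lemma num_normalized_ge d : (#|F| ^ 'C(m + d.+1, m) <= #|F| * N d.+1)%N.
Proof.
have m0 : (0 < m)%N by lia.
have := num_normalizedE d; have := card_finField_gt1.
have : (0 < 'C(m + d, m - 1))%N by rewrite bin_gt0; lia.
rewrite binD1l //; case: 'C(m + d, m - 1) => // e _.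
case: #|F| => [//|r] r0 /=; rewrite addnS expnS expnD -(leq_pmul2l r0).
have : (0 < r.+1 ^ e)%N by rewrite expn_gt0.
set X := (_ ^ 'C(m + d, m))%N; set Y := (_ ^ e)%N; set n := num_normalized _ _ _.
move=> Y0 E; have XY : (r.+1 * X <= r.+1 * (X * Y))%N by rewrite leq_mul2l leq_pmulr ?orbT.
by move/(congr1 (muln r.+1)): E; nia.
Qed.

(** The exponent is a_2 plus 1; the extra factor pays for one use of [num_normalized_ge]. *)
Let K := (#|F| ^ ('C(m + 2, m)).+1)%N.

Lemma num_normalized_step d : (#|F| ^ d.+1 * N d.+1 <= #|F| * N d.+2)%N.
Proof.
apply: leq_trans (num_normalized_ge _).
apply: leq_trans (leq_mul (leqnn _) (num_normalized_le _)) _.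
have q1 := card_finField_gt1; rewrite -expnD leq_exp2l // (binD1l d.+1); last by lia.
rewrite addnC leq_add2l (_ : m + d.+1 = m - 1 + d.+2)%N; last by lia.
by apply: leq_trans (ltn_bin_addl _ _); lia.
Qed.

Lemma num_normalized_mul_le d k : (2 <= k < d.+1)%N ->
  (#|F| ^ d.+2 * (N k * N (d.+2 - k)) <= K * N d.+1)%N.
Proof.
move=> /andP[k2 kd]; have q1 := card_finField_gt1.
have -> : (K * N d.+1 = #|F| ^ 'C(m + 2, m) * (#|F| * N d.+1))%N by rewrite /K expnS; lia.
apply: leq_trans (leq_mul (leqnn _) (num_normalized_ge _)).
have le_k : (N k <= #|F| ^ 'C(m + k, m))%N.
  by case: k k2 {kd} => // k _; apply: num_normalized_le.
have le_dk : (N (d.+2 - k) <= #|F| ^ 'C(m + (d.+2 - k), m))%N.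
  by rewrite (_ : d.+2 - k = (d.+1 - k).+1)%N; [apply: num_normalized_le|lia].
apply: leq_trans (leq_mul (leqnn _) (leq_mul le_k le_dk)) _.
rewrite -!expnD leq_exp2l // (@binD1l m d); last by lia.
(* Convexity gives a_k + a_(d+2-k) <= a_2 + a_d; the step from a_d to a_(d+1) then exceeds [d.+1],
   which absorbs [#|F| ^ d.+2]. *)
have := @leq_bin_convex m 2 (d.+2 - k) (k - 2).
rewrite (_ : 2 + (k - 2) = k)%N; last by lia.
rewrite (_ : d.+2 - k + (k - 2) = d)%N; last by lia.
have := @ltn_bin_addl (m - 1) d.+1.
rewrite (_ : m - 1 + d.+1 = m + d)%N; last by lia.
lia.
Qed.

Lemma num_normalized_gt0 d : (0 < N d.+1)%N.
Proof.
have := num_normalized_ge d; case: (N d.+1) => //; rewrite muln0 leqn0 expn_eq0.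
by have := card_finField_gt1; lia.
Qed.

Lemma exp_card_reducibles_le d :
  (#|F| ^ d.+2 * #|` fset_set (reducibles d.+2)| <=
   #|F| ^ d.+2 * (N 1 * N d.+1) + d * K * N d.+1)%N.
Proof.
apply: leq_trans (leq_mul (leqnn _) (card_reducibles_le _)) _.
rewrite mulnDr leq_add2l big_distrr /= -mulnA.
apply: leq_trans (_ : \sum_(2 <= k < d.+1) K * N d.+1 <= _)%N.
  by rewrite !big_nat; apply: leq_sum => k; apply: num_normalized_mul_le.
by rewrite sum_nat_const_nat leq_mul2r; lia.
Qed.

(** [leq_exp_linear] is applied to the excess over the main term [N 1 * N d.+1]. *)
Lemma card_reducibles_upper d :
  (d.+1 * #|` fset_set (reducibles d.+2)| <=
   d.+1 * (N 1 * N d.+1) + 4 * K * N d.+1)%N.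
Proof.
have := @leq_exp_linear #|F| d 0 K
  (#|` fset_set (reducibles d.+2)| - N 1 * N d.+1) (N d.+1) card_finField_gt1.
rewrite !add0n !mulnBr; have := exp_card_reducibles_le d; lia.
Qed.

(** Here the main term is also compared with [N d.+2] by [num_normalized_step], at the cost of
    [#|F| ^ 2]; the proportion of reducibles is thus O(1/d). *)
Lemma card_reducibles_small d :
  (d.+1 * #|` fset_set (reducibles d.+2)| <= 4 * (N 1 * #|F| ^ 2 + K) * N d.+2)%N.
Proof.
apply: (leq_exp_linear card_finField_gt1).
apply: leq_trans (exp_card_reducibles_le d) _.
have step := num_normalized_step d; have q1 := card_finField_gt1.
have le_N : (N d.+1 <= N d.+2)%N.
  rewrite -(leq_pmul2l (_ : 0 < #|F|)%N); last by lia.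
  by rewrite (leq_trans _ step) // leq_mul2r -{1}(expn1 #|F|) leq_exp2l // orbT.
rewrite mulnDl; apply: leq_add; last by rewrite leq_mul.
rewrite mulnCA -[leqRHS]mulnA leq_mul2l; apply/orP; right.
by rewrite (expnS _ d.+1) -mulnn -!mulnA leq_mul2l step orbT.
Qed.

(** In [N 1 * I(d+2)], replacing irreducibles by all normalized polynomials costs only the small
    proportion of reducibles. *)
Lemma card_reducibles_lower d :
  (d.+1 * (N 1 * N d.+2) <=
   d.+1 * #|` fset_set (reducibles d.+3)| +
   N 1 * (4 * (N 1 * #|F| ^ 2 + K) * N d.+2))%N.
Proof.
have := card_reducibles_ge (isT : 1 < d.+2)%N.
have := card_reducibles_small d; have := num_normalized_split d.+2.
set I := num_normalized_irreducible _ _ _; set r := #|` _|; set r' := #|` _|.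
move=> -> /(leq_mul (leqnn (N 1))) h1 h2.
rewrite mulnDr mulnDr; apply: leq_add; first by rewrite leq_mul2l h2 orbT.
by rewrite mulnCA.
Qed.

End Polynomials.

(** * Passage to the limit *)

(** Used with [c / k] equal to N(1), [a] a power of [q], and [x], [y] the ratios of consecutive
    powers [q ^ a_d]. *)
Lemma cancel_ratio (K : fieldType) (a x y c k : K) :
  a != 0 -> x != 0 -> y != 0 -> y - 1 != 0 -> c != 0 -> k != 0 ->
  c / k * ((a * x - a) / k / ((a * x * y - a * x) / k)) / (c / k * (1 / y)) =
  (1 - x^-1) / (1 - y^-1).
Proof.
move=> a0 x0 y0 y1 c0 k0; have ->: a * x * y - a * x = a * x * (y - 1) by ring.
by field; rewrite a0 x0 y0 y1 c0 k0.
Qed.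

(** [r] counts reducibles and [x] is the main term. The weights [a + 1] and [a] differ because the
    upper and lower bounds are shifted by one degree. *)
Lemma norm_ratio_sub1_le (R : realFieldType) (a C x y r : R) :
  0 < a -> 0 <= C -> 0 < x -> y <= x ->
  (a + 1) * r <= (a + 1) * x + C * y -> a * x <= a * r + C * x ->
  `|r / x - 1| <= C / a.
Proof.
move=> a0 C0 x0 yx up low.
have -> : r / x - 1 = (r - x) / x by field; apply: lt0r_neq0.
rewrite normrM (gtr0_norm (_ : 0 < x^-1)) ?invr_gt0 // ler_pdivrMr // mulrAC.
rewrite ler_pdivlMr // -[X in _ * X](gtr0_norm a0) -normrM ler_norml.
have Cyx : C * y <= C * x by rewrite ler_wpM2l.
have Cx : 0 <= C * x by rewrite mulr_ge0 // ltW.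
apply/andP; split; first lra.
by case: (lerP r x) => rx; nra.
Qed.

Lemma cvg_near1 (R : realType) (C : R) (u : nat -> R) :
  (forall n, `|u n - 1| <= C / n.+1%:R) -> u @ \oo --> (1 : R).
Proof.
move=> uC; have Ch (a : R) : (fun n => 1 + a * n.+1%:R^-1) @ \oo --> (1 : R).
  rewrite -[X in _ --> X]addr0; apply: cvgD; first exact: cvg_cst.
  by rewrite -(mulr0 a); apply: cvgM; [exact: cvg_cst|exact: cvg_harmonic].
apply: (squeeze_cvgr _ (Ch (- C)) (Ch C)); apply: nearW => n.
by have := uC n; rewrite ler_norml mulNr lerBrDr lerBlDl [- _ + 1]addrC.
Qed.

Theorem theorem7 (R : realType) (p n m q : nat) (F : finFieldType)
    (s : nat -> seq 'X_{1..m})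
    (hp : prime p) (hn : (1 <= n)%N) (hq : q = (p ^ n)%N) (hF : #|F| = q)
    (hm : (2 <= m)%N) (hs : monomial_ordering s) :
  let N (d : nat) : R := (num_normalized F s d)%:R in
  let I (d : nat) : R := (num_normalized_irreducible F s d)%:R in
  asymp_equiv (fun d => 1 - I d / N d)
              (fun d => N 1%N * (N d.-1 / N d))
  /\
  asymp_equiv (fun d => N 1%N * (N d.-1 / N d))
              (fun d => (q%:R ^+ m.+1 - q%:R) / (q%:R - 1)
                        * (1 / q%:R ^+ 'C(m + d - 1, m - 1))).
Proof.
move=> N I; have q1 : (1 < q)%N by rewrite -hF card_finField_gt1.
have N_gt0 d : 0 < N d.+1 by rewrite ltr0n; apply: num_normalized_gt0.
have Q1 : (1 : R) < q%:R by rewrite (ltr_nat R 1).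
have Qn1 : q%:R - 1 != 0 :> R by rewrite subr_eq0 gt_eqF.
have NE d : N d.+1 = (q%:R ^+ 'C(m + d.+1, m) - q%:R ^+ 'C(m + d, m)) / (q%:R - 1).
  apply: (mulIf Qn1); rewrite divfK //; apply/esym/eqP.
  rewrite subr_eq -!natrX -hF -(num_normalizedE F hs) natrD natrM mulrC.
  by rewrite -subn1 natrB // hF ltnW.
split.
(* The lower bound on reducibles starts in degree 3. *)
- rewrite /asymp_equiv -(cvg_shiftn 3).
  pose C : R := (4 * (num_normalized F s 1 * #|F| ^ 2 + #|F| ^ ('C(m + 2, m)).+1))%:R.
  apply: (@cvg_near1 _ C) => d; rewrite /= addn3 /=.
  set r : R := #|` fset_set (reducibles (F := F) s d.+3)|%:R.
  have -> : (1 - I d.+3 / N d.+3) / (N 1%N * (N d.+2 / N d.+3)) = r / (N 1%N * N d.+2).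
    have -> : I d.+3 = N d.+3 - r.
      by rewrite /N (num_normalized_split F s d.+3) natrD addrK.
    by field; apply/and3P; split; apply/lt0r_neq0/N_gt0.
  have up : d.+2%:R * r <= d.+2%:R * (N 1%N * N d.+2) + C * N d.+2.
    rewrite /r /N /C -!natrM -natrD ler_nat.
    apply: leq_trans (card_reducibles_upper F hs hm d.+1) _.
    by rewrite leq_add2l leq_mul2r leq_mul2l leq_addl !orbT.
  have low : d.+1%:R * (N 1%N * N d.+2) <= d.+1%:R * r + N 1%N * (C * N d.+2).
    rewrite /r /N /C -!natrM -natrD ler_nat.
    exact: (card_reducibles_lower F hs hm).
  have X0 : 0 < N 1%N * N d.+2 by rewrite mulr_gt0.
  have le_X : N d.+2 <= N 1%N * N d.+2.
    by apply: ler_peMl; [exact/ltW|rewrite ler1n -(ltr0n R); exact: N_gt0].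
  have a0 : (0 : R) < d.+1%:R by rewrite ltr0n.
  have C0 : 0 <= C by rewrite ler0n.
  apply: (norm_ratio_sub1_le a0 C0 X0 le_X); first by rewrite -natr1 in up.
  by rewrite (mulrCA C).
(* After the shift both degrees are positive, so [NE] applies to each count. *)
- rewrite /asymp_equiv -(cvg_shiftn 2).
  pose w e : R := (q%:R ^+ 'C(m + e, m - 1))^-1.
  (* The exponent exceeds [e.+1], so [w e] is at most the harmonic term [1 / e.+1]. *)
  have w0 : w @ \oo --> (0 : R).
    apply: (squeeze_cvgr _ (cvg_cst _) (@cvg_harmonic R)); apply: nearW => e.
    rewrite invr_ge0 exprn_ge0 ?ler0n //= lef_pV2 ?posrE ?exprn_gt0 ?ltr0n //; last lia.
    rewrite -natrX ler_nat (leq_trans _ (ltnW (ltn_expl _ q1))) //.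
    rewrite (_ : m + e = m - 1 + e.+1)%N; last by lia.
    by rewrite (leq_trans _ (ltn_bin_addl _ _)) //; lia.
  have w1 : (fun e => (1 - w e) / (1 - w e.+1)) @ \oo --> (1 : R).
    rewrite -[X in _ --> X](_ : (1 - 0) / (1 - 0) = 1 :> R); last by rewrite subr0 divr1.
    apply: cvgM; first by apply: cvgB => //; exact: cvg_cst.
    apply: cvgV; first by rewrite subr0 oner_eq0.
    by apply: cvgB; [exact: cvg_cst|rewrite cvg_shiftS].
  apply: cvg_trans w1; apply: near_eq_cvg; apply: nearW => e.
  rewrite /= addn2 /= (_ : m + e.+2 - 1 = m + e.+1)%N; last by lia.
  rewrite !NE addn1 addn0 binSn binn expr1.
  have m0 : (0 < m)%N by lia.
  have binE k : q%:R ^+ 'C(m + k.+1, m) =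
      q%:R ^+ 'C(m + k, m) * q%:R ^+ 'C(m + k, m - 1) :> R.
    by rewrite binD1l // exprD.
  rewrite !binE /w.
  have Q0 k : q%:R ^+ k != 0 :> R by rewrite expf_neq0 // lt0r_neq0 //; lra.
  have Qgt1 k : (0 < k)%N -> 1 < q%:R ^+ k :> R by move=> k0; rewrite exprn_egt1 // -lt0n.
  have bin_pos k : (0 < 'C(m + k, m - 1))%N by rewrite bin_gt0; lia.
  have N10 : q%:R ^+ m.+1 - q%:R != 0 :> R.
    by rewrite exprS -[X in _ - X]mulr1 -mulrBr mulf_neq0 // lt0r_neq0 ?subr_gt0 ?Qgt1 //; lra.
  by rewrite [RHS]cancel_ratio // subr_eq0 gt_eqF // Qgt1 //.
Qed.
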